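(* Let $n\ge1$ and let $E$ be any mapping on $\{0,1\}^n$. Then $E$ is computed by an in situ program of length $4n-3$ and signature $1,\dots,n,n-1,\dots,1,2,\dots,n,n-1,\dots,1$, obtained as follows. Take a partition-sequence $P=(P_0,\dots,P_{2^n-1})$ whose non-empty members are exactly the non-empty fibres $E^{-1}(y)$, ordered so that $[|P_0|,\dots,|P_{2^n-1}|]$ is a block-sequence (such an ordering exists), and a $P$-factorisation $(F,I,G)$ of $E$. Take in situ programs of $G$ and of $F$ with signature $1,\dots,n,\dots,1$; let $B$ be the mapping computed by the first $n$ assignments of the program of $F$. Then the program consisting of the program of $G$, followed by the in situ program of $B\circ I$ with signature $1,\dots,n$, followed by the last $n-1$ assignments of the program of $F$, with consecutive assignments on the same component merged into one, computes $E$. Equivalently in network terms: $B^{-1}|B|B^{-1}|B$ (here $B$ denotes the butterfly network) has a routing performing $E$, and $B|B^{-1}|B|B^{-1}$ has a multicast routing performing $E^{-1}$.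
   Context: An in situ program of a mapping $E:\{0,1\}^n\to\{0,1\}^n$ is a finite sequence $(\psi_1,i_1),\dots,(\psi_m,i_m)$ with $\psi_k:\{0,1\}^n\to\{0,1\}$, $i_k\in\{1,\dots,n\}$, such that for every $X$, setting $X_0=X$ and letting $X_k$ equal $X_{k-1}$ except that its $i_k$-th component is replaced by $\psi_k(X_{k-1})$, one has $X_m=E(X)$; its length is $m$ and signature $i_1,\dots,i_m$. The index of $(x_1,\dots,x_n)$ is $x_1+2x_2+\dots+2^{n-1}x_n$, and $X_i$ is the vector of index $i$. A partition-sequence is a sequence $P=(P_0,\dots,P_k)$ of subsets whose non-empty members partition $\{0,1\}^n$; $I_P$ sends $X_0,\dots,X_{2^n-1}$ in order to $|P_0|$ copies of $X_0$, then $|P_1|$ copies of $X_1$, etc. A block-sequence is a sequence $[v_0,\dots,v_{2^n-1}]$ of non-negative integers with $\sum_{j2^i\le l<(j+1)2^i}v_l\equiv0\pmod{2^i}$ for all $0\le i\le n$, $0\le j<2^{n-i}$. If each non-empty $P_i$ equals $E^{-1}(y_i)$, a $P$-factorisation of $E$ is a triple $(F,I,G)$ with $I=I_P$, $G$ a bijection mapping $P_i$ onto $I^{-1}(X_i)$ for each $i$, and $F$ a bijection mapping $X_i$ to $y_i$ whenever $P_i\ne\emptyset$; then $E=F\circ I\circ G$. Networks: a MIN is a directed graph with stages (copies of $\{0,1\}^n$) and edges only between consecutive stages; $A_i$ has two stages with edges from $(x_1,\dots,x_n)$ to $(x_1,\dots,x_{i-1},e,x_{i+1},\dots,x_n)$,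 $e\in\{0,1\}$; $M|M'$ is concatenation identifying the last stage of $M$ with the first of $M'$; the butterfly is $B=A_n|\dots|A_1$ and $B^{-1}=A_1|\dots|A_n$. A routing chooses one outgoing edge at each vertex of every non-final stage and performs $E$ if the chosen path from each first-stage $X$ ends at $E(X)$. A multicast routing performing $E^{-1}$ is a choice of edges such that each vertex of each non-initial stage has exactly one chosen incoming edge and, for each first-stage $Y$, the set of final-stage vertices reachable from $Y$ along chosen edges is $E^{-1}(Y)$. *)

(* Defs.v *)
From mathcomp Require Import all_boot.

Set Implicit Arguments.
Unset Strict Implicit.
Unset Printing Implicit Defensive.

(* The component x_i, 1 <= i <= n, of x : bvec n is [x k] with [k : 'I_n] of
   value i - 1; [signature], below, restores the 1-based numbering. *)
Definition bvec (n : nat) := {ffun 'I_n -> bool}.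

Definition update n (x : bvec n) (i : 'I_n) (e : bool) : bvec n :=
  [ffun j => if j == i then e else x j].

Definition bindex n (x : bvec n) : nat := \sum_(i < n) 2 ^ i * x i.

(* The vector X_k; meaningful for k < 2 ^ n, see [vecK] and [bindexK]. *)
Definition vec n (k : nat) : bvec n := [ffun i : 'I_n => odd (k %/ 2 ^ i)].

Lemma vecK n k : k < 2 ^ n -> bindex (vec n k) = k.
Proof.
move=> lt_k; rewrite -[RHS](modn_small lt_k) /bindex {lt_k}.
under eq_bigr do rewrite ffunE.
elim: n => [|n IHn]; first by rewrite big_ord0 expn0 modn1.
rewrite big_ord_recr /= {}IHn.
have e2 : 2 ^ n * 2 = 2 ^ n.+1 by rewrite expnSr.
set m := k %% 2 ^ n; set q := k %/ 2 ^ n.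
have lt_m : m < 2 ^ n by rewrite ltn_pmod ?expn_gt0.
have -> : k = q./2 * 2 ^ n.+1 + (m + 2 ^ n * odd q).
  rewrite {1}(divn_eq k (2 ^ n)) -/q -/m -{1}(odd_double_half q) -muln2 -e2.
  by rewrite mulnDl -mulnA (mulnC 2) (mulnC (_ : bool)) addnAC addnC (addnC m).
rewrite modnMDl modn_small // -e2; case: odd.
  by rewrite muln1 muln2 -addnn ltn_add2r.
by rewrite muln0 addn0 (leq_trans lt_m) // leq_pmulr.
Qed.

Lemma bindexK n (x : bvec n) : vec n (bindex x) = x.
Proof.
pose f (k : 'I_(2 ^ n)) := vec n k.
have fI : injective f.
  by move=> j k /(congr1 (@bindex n)); rewrite !vecK // => /val_inj.
have [|g _ gK] := inj_card_bij fI; first by rewrite card_ffun card_bool !card_ord.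
by rewrite -[in LHS](gK x) vecK //; apply: gK.
Qed.

Definition assignment (n : nat) := ((bvec n -> bool) * 'I_n)%type.
Definition program (n : nat) := seq (assignment n).

Definition assign n (x : bvec n) (a : assignment n) : bvec n :=
  update x a.2 (a.1 x).

Definition run n (p : program n) (x : bvec n) : bvec n :=
  foldl (@assign n) x p.

Definition in_situ_program n (p : program n) (E : bvec n -> bvec n) : Prop :=
  forall x, run p x = E x.

Definition signature n (p : program n) : seq nat :=
  [seq (nat_of_ord a.2).+1 | a <- p].

Definition sig_up (n : nat) : seq nat := iota 1 n.
Definition sig_down (n : nat) : seq nat := rev (iota 1 n.-1).
Definition sig_updown (n : nat) : seq nat := sig_up n ++ sig_down n.
Definition sig_main (n : nat) : seq nat :=
  sig_up n ++ sig_down n ++ iota 2 n.-1 ++ sig_down n.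

(* For a.2 = b.2, the single assignment with the effect of a followed by b. *)
Definition merge2 n (a b : assignment n) : assignment n :=
  (fun x => b.1 (assign x a), b.2).

Fixpoint merge_program n (p : program n) : program n :=
  if p is a :: q then
    if merge_program q is b :: r then
      if a.2 == b.2 then merge2 a b :: r else [:: a, b & r]
    else [:: a]
  else [::].

Definition fibre n (E : bvec n -> bvec n) (y : bvec n) : {set bvec n} :=
  E @^-1: [set y].

Definition nonempty_members n (P : seq {set bvec n}) : seq {set bvec n} :=
  [seq A <- P | A != set0].

Definition partition_sequence n (P : seq {set bvec n}) : Prop :=
  uniq (nonempty_members P) /\
  partition [set A in nonempty_members P] [set: bvec n].

Definition I_ n (P : seq {set bvec n}) (x : bvec n) : bvec n :=
  nth (vec n 0)
    (flatten [seq nseq #|nth set0 P i| (vec n i) | i <- iota 0 (size P)])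
    (bindex x).

Definition block_sequence (n : nat) (v : seq nat) : Prop :=
  size v = 2 ^ n /\
  forall i j, i <= n -> j < 2 ^ (n - i) ->
    \sum_(j * 2 ^ i <= l < j.+1 * 2 ^ i) nth 0 v l = 0 %[mod 2 ^ i].

Definition block_fibre_sequence n (E : bvec n -> bvec n)
    (P : seq {set bvec n}) : Prop :=
  [/\ size P = 2 ^ n,
      partition_sequence P,
      forall A : {set bvec n},
        A \in nonempty_members P <-> A != set0 /\ exists y, A = fibre E y
    & block_sequence n [seq #|A : {set bvec n}| | A <- P]].

Definition P_factorisation n (P : seq {set bvec n})
    (E F I G : bvec n -> bvec n) : Prop :=
  [/\ I =1 I_ P,
      bijective G,
      forall i, i < size P -> G @: nth set0 P i = I @^-1: [set vec n i],
      bijective F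
    & exists y : nat -> bvec n,
        forall i, i < size P -> nth set0 P i != set0 ->
          nth set0 P i = fibre E (y i) /\ F (vec n i) = y i].

(* Networks: a MIN with m + 1 stages is the sequence of its m edge relations,
   the k-th one relating stage k to stage k + 1 (stages numbered from 0), so
   that concatenation is [++]. *)
Definition MIN (n : nat) := seq (rel (bvec n)).

Definition no_edge n : rel (bvec n) := fun _ _ => false.

Definition A_ n (i : 'I_n) : MIN n :=
  [:: fun x y => [exists e : bool, y == update x i e]].

Definition butterfly (n : nat) : MIN n :=
  flatten [seq A_ i | i <- rev (enum 'I_n)].
Definition inv_butterfly (n : nat) : MIN n :=
  flatten [seq A_ i | i <- enum 'I_n].

(* [C k x y] : the edge from x in stage k to y in stage k + 1 is chosen. *)
Definition edge_choice n (M : MIN n) (C : nat -> rel (bvec n)) : Prop :=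
  forall k x y, k < size M -> C k x y -> nth (@no_edge n) M k x y.

Definition chosen_path n (M : MIN n) (C : nat -> rel (bvec n))
    (x z : bvec n) : Prop :=
  exists w : nat -> bvec n,
    [/\ w 0 = x, w (size M) = z & forall k, k < size M -> C k (w k) (w k.+1)].

Definition routing n (M : MIN n) (C : nat -> rel (bvec n)) : Prop :=
  edge_choice M C /\
  forall k x, k < size M -> #|[set y | C k x y]| = 1.

Definition routing_performs n (M : MIN n) (C : nat -> rel (bvec n))
    (E : bvec n -> bvec n) : Prop :=
  routing M C /\ forall x, chosen_path M C x (E x).

Definition multicast_routing_performs_inverse n (M : MIN n)
    (C : nat -> rel (bvec n)) (E : bvec n -> bvec n) : Prop :=
  [/\ edge_choice M C,
      forall k y, k < size M -> #|[set x | C k x y]| = 1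
    & forall y z, chosen_path M C y z <-> z \in fibre E y].

(* Main.v *)
Require Import Defs.
From mathcomp Require Import all_boot.
From mathcomp Require Import zify.

(* A bijection is computed with signature 1, ..., n, ..., 1 because the Benes
   network is rearrangeable: the outer two assignments come from a 2-colouring
   of a union of even cycles, and what remains fixes one more component.
   Pairing fibres by the parity of their sizes, recursively, orders them into a
   block-sequence, and then I maps aligned blocks of length 2 ^ k into aligned
   blocks of length 2 ^ k.  Since each prefix of the program of F is injective,
   B o I never has to distinguish two points after they have been merged, so it
   can be computed in the order 1, ..., n.
   The networks read off the program, padded by two no-ops on component n; for
   the multicast one the program is that of E conjugated by the reversal of the
   components, because 1, ..., n, n, ..., 1 is a palindrome. *)

(** * Bijections *)

(* In a graph whose edges join x to s x and to t x, the orbits of t \o s are the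
   two halves of the even cycles, and s and t both exchange these halves. *)
Lemma involutions_two_colouring (T : finType) (s t : T -> T) :
  involutive s -> involutive t ->
  (forall x, s x != x) -> (forall x, t x != x) ->
  exists a : T -> bool, forall x, a (s x) = ~~ a x /\ a (t x) = ~~ a x.
Proof.
move=> sK tK s_neq t_neq; pose f x := t (s x).
have f_inj : injective f by apply: inj_comp; apply: can_inj.
have f_sym := fconnect_sym f_inj.
(* Cancelling one [f] replaces [k] and [x] by [k - 2] and [f x], down to a fixed point of [s] or of
   [t]. *)
have not_fs k x : iter k f x <> s x.
  have [m le_km] := ubnP k; elim: m => // m IHm in k x le_km *.
  case: k => [|[|k]] in le_km *.
  - by move=> /esym/eqP; rewrite (negPf (s_neq x)).
  - by move=> /eqP; rewrite (negPf (t_neq _)).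
  rewrite iterS => fs; apply: (IHm k (f x)); first by lia.
  by apply: f_inj; rewrite -iterSr fs /f sK tK.
pose r x := enum_rank (froot f x).
have r_s x : r x != r (s x).
  apply/eqP => /enum_rank_inj /(rootP f_sym) /iter_findex.
  exact: not_fs.
have r_f x : r (f x) = r x.
  by congr enum_rank; apply/esym/(rootP f_sym)/fconnect1.
(* The colour tells which of the orbits of [x] and [s x] has the smaller rank; [t x] lies in the
   orbit of [s x]. *)
exists (fun x => r x < r (s x)) => x.
have r_t : r (t x) = r (s x) by rewrite -[x in t x]sK r_f.
have r_st : r (s (t x)) = r x by rewrite -r_f /f sK tK.
by rewrite sK r_t r_st; have := r_s x; rewrite -val_eqE /=; split; lia.
Qed.

Lemma update_id {n} (x : bvec n) (i : 'I_n) : update x i (x i) = x.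
Proof. by apply/ffunP => j; rewrite ffunE; case: eqP => [->|]. Qed.

Lemma update_eq {n} (x : bvec n) (i : 'I_n) e : update x i e i = e.
Proof. by rewrite ffunE eqxx. Qed.

Lemma update_neq {n} (x : bvec n) (i j : 'I_n) e :
  j != i -> update x i e j = x j.
Proof. by rewrite ffunE => /negPf->. Qed.

Lemma update_update {n} (x : bvec n) (i : 'I_n) d e :
  update (update x i d) i e = update x i e.
Proof. by apply/ffunP => j; rewrite !ffunE; case: eqP. Qed.

Definition flip {n} (i : 'I_n) (x : bvec n) : bvec n := update x i (~~ x i).

Lemma flipK {n} (i : 'I_n) : involutive (flip i).
Proof. by move=> x; rewrite /flip update_update update_eq negbK update_id. Qed.

Lemma flip_neq {n} (i : 'I_n) (x : bvec n) : flip i x != x.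
Proof. by apply/eqP => /ffunP/(_ i); rewrite update_eq; case: (x i). Qed.

(** Points with the same image agree off component [i], so they are equal or differ by [flip i]; in
    the latter case [a] tells them apart. *)
Lemma update_inj_flip {n} (i : 'I_n) (a : bvec n -> bool) :
  (forall x, a (flip i x) = ~~ a x) -> injective (fun x => update x i (a x)).
Proof.
move=> a_flip x y /ffunP e.
have exy : x = update y i (x i).
  apply/ffunP => j; rewrite ffunE; have [->//|ji] := eqVneq j i.
  by have := e j; rewrite !update_neq.
have [xi|xi] := eqVneq (x i) (y i); first by rewrite exy xi update_id.
have := e i; rewrite !update_eq exy.
have -> : x i = ~~ y i by case: (x i) (y i) xi => [] [].
by rewrite -/(flip i y) a_flip; case: (a y).
Qed.

Lemma signature_cat {n} (p q : program n) :
  signature (p ++ q) = signature p ++ signature q.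
Proof. exact: map_cat. Qed.

Lemma signature_take {n} (p : program n) k :
  signature (take k p) = take k (signature p).
Proof. exact: map_take. Qed.

Lemma signature_drop {n} (p : program n) k :
  signature (drop k p) = drop k (signature p).
Proof. exact: map_drop. Qed.

Lemma size_signature {n} (p : program n) : size (signature p) = size p.
Proof. exact: size_map. Qed.

Lemma run_cat {n} (p q : program n) x : run (p ++ q) x = run q (run p x).
Proof. exact: foldl_cat. Qed.

Lemma run_rcons {n} (p : program n) a x :
  run (rcons p a) x = assign (run p x) a.
Proof. exact: foldl_rcons. Qed.

Lemma run_notin_signature {n} (p : program n) x (j : 'I_n) :
  j.+1 \notin signature p -> run p x j = x j.
Proof.
elim: p x => //= a p IHp x; rewrite inE negb_or eqSS => /andP[ja /IHp->].
exact: update_neq.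
Qed.

(* Colour the points so that x and flip i x get different colours, and so do
   the F-preimages of z and flip i z.  Writing the colour into component i, on
   the left (U) and on the right (V), is then bijective, and V o F o U^-1 fixes
   component i as well. *)
Lemma bijection_program_from {n} m k : k + m.+1 = n ->
  forall F : bvec n -> bvec n, injective F ->
  (forall x (j : 'I_n), j < k -> F x j = x j) ->
  exists p : program n,
    in_situ_program p F /\ signature p = iota k.+1 m.+1 ++ rev (iota k.+1 m).
Proof.
elim: m k => [|m IHm] k kmn F F_inj F_fix.
  have lt_kn : k < n by lia.
  pose i := Ordinal lt_kn.
  exists [:: (fun x => F x i, i)]; split=> // x /=; apply/ffunP => j.
  rewrite ffunE /=; case: eqP => [->//|/eqP]; rewrite -val_eqE /= => ji.
  by rewrite F_fix //; have := ltn_ord j; lia.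
have lt_kn : k < n by lia.
pose i := Ordinal lt_kn.
have [G FK GK] := injF_bij F_inj.
(* The partner of [x] on the output side: [F (t x)] is [flip i (F x)]. *)
pose t x := G (flip i (F x)).
have tK : involutive t by move=> x; rewrite /t GK flipK FK.
have t_neq x : t x != x.
  by apply: contra (flip_neq i (F x)) => /eqP{2}<-; rewrite /t GK.
have [a a_col] :=
  @involutions_two_colouring _ _ t (flipK i) tK (flip_neq i) t_neq.
pose U x := update x i (a x).
pose V z := update z i (a (G z)).
have U_inj : injective U by apply: update_inj_flip => x; case: (a_col x).
have V_inj : injective V.
  apply: (@update_inj_flip _ _ (a \o G)) => z /=.
  by have [_] := a_col (G z); rewrite /t GK.
have [U' UK U'K] := injF_bij U_inj.
have [V' VK V'K] := injF_bij V_inj.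
have V'E w j : j != i -> V' w j = w j.
  by move=> ji; rewrite -[w in RHS]V'K update_neq.
have U'E w j : j != i -> U' w j = w j.
  by move=> ji; rewrite -[w in RHS]U'K update_neq.
pose M w := V (F (U' w)).
have M_inj : injective M by do 2!apply: inj_comp => //; apply: can_inj U'K.
have M_fix w (j : 'I_n) : j < k.+1 -> M w j = w j.
  (* [U' w] has colour [w i], and after [F] the same colour is written back by [V]. *)
  rewrite /M => le_jk; have [->|ji] := eqVneq j i.
    by rewrite update_eq FK -[w in RHS]U'K update_eq.
  have lt_jk : j < k by move: ji; rewrite -val_eqE /=; lia.
  by rewrite update_neq // F_fix // U'E.
have [|p [pM p_sig]] := IHm k.+1 _ M M_inj M_fix; first by lia.
(* The first assignment performs [U], and the last one undoes [V], which changes component [i]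
   only. *)
exists ((a, i) :: rcons p (fun w => V' w i, i)); split.
  move=> x; rewrite /= run_rcons -/(run p _) pM /assign /=.
  rewrite /M -/(U x) UK; set w := V (F x).
  have <- : V' w = F x by rewrite VK.
  apply/ffunP => j; rewrite ffunE; case: eqP => [->//|/eqP ji].
  by rewrite V'E.
rewrite /signature /= map_rcons -/(signature p) p_sig /=.
by rewrite rcons_cat rev_cons.
Qed.

Lemma bijection_program {n} (F : bvec n -> bvec n) :
  0 < n -> injective F ->
  exists p : program n, in_situ_program p F /\ signature p = sig_updown n.
Proof.
case: n F => // n F _ F_inj.
exact: (@bijection_program_from n.+1 n 0).
Qed.

(** * Programs with signature 1, ..., n *)

Lemma run_take_up {n} (p : program n) k x (j : 'I_n) :
  signature p = sig_up n ->
  run (take k p) x j = if j < k then run p x j else x j.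
Proof.
move=> p_sig; case: ltnP => [lt_jk|le_kj].
  rewrite -[in RHS](cat_take_drop k p) run_cat [RHS]run_notin_signature //.
  by rewrite signature_drop p_sig drop_iota mem_iota; lia.
apply: run_notin_signature.
by rewrite signature_take p_sig take_iota mem_iota; lia.
Qed.

(** By hypothesis the state after [k] assignments, made of [k] components of [f x] and the remaining
    ones of [x], determines [f x], hence the next component to write. *)
Lemma up_program {n} (f : bvec n -> bvec n) :
  (forall k x y, k <= n -> (forall j : 'I_n, j < k -> f x j = f y j) ->
     (forall j : 'I_n, k <= j -> x j = y j) -> f x = f y) ->
  exists p : program n, in_situ_program p f /\ signature p = sig_up n.
Proof.
move=> f_det.
pose mix k x : bvec n := [ffun j : 'I_n => if j < k then f x j else x j].
have mix_det k x y : k <= n -> mix k x = mix k y -> f x = f y.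
  move=> le_kn /ffunP e; apply: (f_det k) => // j jk;
    have := e j; rewrite !ffunE.
    by rewrite jk.
  by rewrite ltnNge jk.
suff /(_ n (leqnn n)) [p [pE p_sig]] : forall k, k <= n ->
    exists p : program n, in_situ_program p (mix k) /\ signature p = iota 1 k.
  exists p; split=> // x; rewrite pE; apply/ffunP => j.
  by rewrite ffunE ltn_ord.
elim=> [|k IHk] le_kn.
  by exists [::]; split=> // x; apply/ffunP => j; rewrite ffunE.
have [p [pE p_sig]] := IHk (ltnW le_kn); pose i := Ordinal le_kn.
(* Any [x] leading to the state [z] serves, by [mix_det]; [false] is for states that never occur. *)
pose psi z := if [pick x | mix k x == z] is Some x then f x i else false.
exists (rcons p (psi, i)); split; last first.
  rewrite /signature map_rcons -/(signature p) p_sig.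
  by rewrite -cats1 -[k.+1 in RHS]addn1 iotaD.
move=> x; rewrite run_rcons pE /assign /= /psi.
case: pickP => [y /eqP /(mix_det _ _ _ (ltnW le_kn)) ->|/(_ x)];
  last by rewrite eqxx.
apply/ffunP => j; rewrite !ffunE -val_eqE /= ltnS; case: ltngtP => // ji.
by have -> : j = i by apply: val_inj.
Qed.

(** * Merging and its effect on signatures *)

Fixpoint compress (s : seq nat) : seq nat :=
  if s is a :: q then
    if compress q is b :: r then
      if a == b then b :: r else [:: a, b & r]
    else [:: a]
  else [::].

Lemma signature_merge {n} (p : program n) :
  signature (merge_program p) = compress (signature p).
Proof.
elim: p => //= a p; rewrite -/(signature p) => <-.
by case: (merge_program p) => //= b r; rewrite eqSS val_eqE; case: eqP.
Qed.

Lemma run_merge {n} (p : program n) x : run (merge_program p) x = run p x.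
Proof.
elim: p x => //= a p IHp x; rewrite -IHp.
case: (merge_program p) => //= b r; case: eqP => //= ab.
congr (foldl _ _ _); rewrite /assign /=.
by rewrite -ab update_update.
Qed.

Lemma compress_id s : sorted (fun a b => a != b) s -> compress s = s.
Proof.
elim: s => //= a s IHs; case: s IHs => //= b s IHs /andP[/negPf ab /IHs].
by move=> ->; rewrite ab.
Qed.

Lemma compress_cat s t c :
  compress (rcons s c ++ c :: t) = compress (rcons s c ++ t).
Proof.
elim: s => [|a s IHs] /=; last by rewrite IHs.
by case: (compress t) => [|b r]; rewrite ?eqxx //;
  case: eqP => [->|]; rewrite eqxx.
Qed.

(** * Block-sequences *)

(** Among three weights two have the same parity: these are paired and the third returns to the
    rest. The even total settles the last pair. *)
Lemma even_pairing {T : eqType} (w : T -> nat) m (s : seq T) :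
  size s = m.*2 -> ~~ odd (\sum_(x <- s) w x) ->
  exists ps : seq (T * T),
    [/\ size ps = m, all (fun p => ~~ odd (w p.1 + w p.2)) ps
      & perm_eq (flatten [seq [:: p.1; p.2] | p <- ps]) s].
Proof.
elim: m s => [|m IHm] s; first by case: s => // _ _; exists [::].
case: s => [|a [|b s]] //= [sz_s].
have pick_pair x y z s' : size (z :: s') = m.*2 ->
    perm_eq [:: x, y, z & s'] [:: a, b & s] ->
    ~~ odd (w x + w y) -> ~~ odd (w z + \sum_(i <- s') w i) ->
    exists ps : seq (T * T),
    [/\ size ps = m.+1, all (fun p => ~~ odd (w p.1 + w p.2)) ps
      & perm_eq (flatten [seq [:: p.1; p.2] | p <- ps]) [:: a, b & s]].
  move=> sz xyz exy ez; have [|ps [sz_ps ps_even ps_perm]] := IHm _ sz.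
    by rewrite big_cons.
  exists ((x, y) :: ps); split=> /=; first by rewrite sz_ps.
    by rewrite exy.
  by apply: perm_trans xyz; rewrite !perm_cons.
case: s sz_s pick_pair => [|c s] sz_s pick_pair.
  rewrite !big_cons big_nil addn0 => ab.
  exists [:: (a, b)]; rewrite /= ab; split=> //.
  by move: sz_s => /=; lia.
rewrite !big_cons => ev.
have [ab|ab] := boolP (odd (w a + w b)); last first.
  by apply: (pick_pair a b c s) => //; lia.
have [ac|ac] := boolP (odd (w a + w c)); last first.
  by apply: (pick_pair a c b s) => //; [apply/permP=> d /=; lia | lia].
by apply: (pick_pair b c a s) => //; [apply/permP=> d /=; lia | lia | lia].
Qed.

Lemma sum_nat_pairs (f : nat -> nat) a b :
  \sum_(a.*2 <= l < b.*2) f l = \sum_(a <= l < b) (f l.*2 + f l.*2.+1).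
Proof.
have [le_ab|lt_ba] := leqP a b; last by rewrite !big_geq //; lia.
elim: b le_ab => [|b IHb] le_ab; first by rewrite !big_geq //; lia.
have [->|neq] := eqVneq a b.+1; first by rewrite !big_geq.
by rewrite doubleS !big_nat_recr ?IHb -?addnA //=; lia.
Qed.

Lemma nth_flatten_pairs {T : Type} (w : T -> nat) (ps : seq (T * T)) l :
  let v := [seq w x | x <- flatten [seq [:: p.1; p.2] | p <- ps]] in
  nth 0 v l.*2 + nth 0 v l.*2.+1 = nth 0 [seq w p.1 + w p.2 | p <- ps] l.
Proof. by elim: ps l => [|p ps IHps] [|l] //=; apply: IHps. Qed.

Lemma sum_flatten_pairs {T : Type} (w : T -> nat) (ps : seq (T * T)) :
  \sum_(x <- flatten [seq [:: p.1; p.2] | p <- ps]) w x =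
  \sum_(p <- ps) (w p.1 + w p.2).
Proof.
by elim: ps => [|p ps IHps]; rewrite /= ?big_nil // !big_cons IHps addnA.
Qed.

(* Pair weights of equal parity and order the half-sums of the pairs
   recursively. *)
Lemma block_ordering n (T : eqType) (w : T -> nat) (s : seq T) :
  size s = 2 ^ n -> 2 ^ n %| \sum_(x <- s) w x ->
  exists s' : seq T, perm_eq s' s /\ block_sequence n [seq w x | x <- s'].
Proof.
elim: n T w s => [|n IHn] T w s sz_s dvd_s.
  exists s; split=> //; split; first by rewrite size_map.
  by move=> [|i] j //; rewrite !modn1.
have sz2 : size s = (2 ^ n).*2 by rewrite sz_s expnS; lia.
have [|ps [sz_ps ps_even ps_perm]] := even_pairing w _ _ sz2.
  by rewrite -dvdn2; apply: dvdn_trans dvd_s; rewrite expnS dvdn_mulr.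
pose w2 (p : T * T) := (w p.1 + w p.2)./2.
have w2E p : p \in ps -> w p.1 + w p.2 = (w2 p).*2.
  by move=> /(allP ps_even) ev; rewrite even_halfK.
(* The half-sums add up to half of the sum over [s], a multiple of [2 ^ n]. *)
have [||ps' [ps'_perm [_ ps'_block]]] := IHn _ w2 ps => //.
  rewrite -(@dvdn_pmul2l 2) // -expnS big_distrr /=.
  rewrite -(perm_big _ ps_perm) sum_flatten_pairs big_seq in dvd_s.
  rewrite big_seq; congr (_ %| _): dvd_s; apply: eq_bigr => p /w2E ->.
  by rewrite mul2n.
have s'_perm : perm_eq (flatten [seq [:: p.1; p.2] | p <- ps']) s.
  by apply: perm_trans ps_perm; apply/perm_flatten/perm_map.
exists (flatten [seq [:: p.1; p.2] | p <- ps']); split=> //; split.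
  by rewrite size_map (perm_size s'_perm).
move=> [|i] j le_in lt_j; first by rewrite !modn1.
have dbl m : m * 2 ^ i.+1 = (m * 2 ^ i).*2 by rewrite expnS; lia.
(* An aligned block of length [2 ^ i.+1] is an aligned block of [2 ^ i] pairs, and its sum is twice
   that of their half-sums. *)
rewrite !dbl sum_nat_pairs; under eq_bigr do rewrite nth_flatten_pairs.
have -> : [seq w p.1 + w p.2 | p <- ps'] = map double (map w2 ps').
  rewrite -map_comp; apply/eq_in_map => p.
  by rewrite (perm_mem ps'_perm) => /w2E.
have nth_dbl l : nth 0 (map double (map w2 ps')) l = 2 * nth 0 (map w2 ps') l.
  have [lt_l|le_l] := ltnP l (size (map w2 ps')).
    by rewrite (nth_map 0) // mul2n.
  by rewrite !nth_default ?size_map // -(size_map w2).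
under eq_bigr do rewrite nth_dbl.
rewrite -big_distrr /= expnS -muln_modr.
by rewrite ps'_block ?mod0n // -subSS.
Qed.

(** * Indices and aligned blocks *)

Lemma bindex_lt {n} (x : bvec n) : bindex x < 2 ^ n.
Proof.
apply: (@leq_ltn_trans (\sum_(i < n) 2 ^ i)).
  by apply: leq_sum => i _; case: (x i); lia.
elim: {x}n => [|n IHn]; first by rewrite big_ord0.
by rewrite big_ord_recr /= expnS mul2n -addnn ltn_add2r.
Qed.

Lemma vec_inj {n} a b : a < 2 ^ n -> b < 2 ^ n -> vec n a = vec n b -> a = b.
Proof. by move=> lta ltb e; rewrite -(vecK lta) e vecK. Qed.

Lemma vec_divn {n} a b k (j : 'I_n) :
  a %/ 2 ^ k = b %/ 2 ^ k -> k <= j -> vec n a j = vec n b j.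
Proof.
move=> ab le_kj; rewrite !ffunE.
have -> : 2 ^ j = 2 ^ k * 2 ^ (j - k) by rewrite -expnD subnKC.
by rewrite !divnMA ab.
Qed.

Lemma bindex_divn {n} (x y : bvec n) k : k <= n ->
  (forall j : 'I_n, k <= j -> x j = y j) ->
  bindex x %/ 2 ^ k = bindex y %/ 2 ^ k.
Proof.
move=> le_kn xy.
have lt (z : bvec n) : bindex z %/ 2 ^ k < 2 ^ (n - k).
  by rewrite ltn_divLR ?expn_gt0 // -expnD subnK // bindex_lt.
(* The quotients are compared bit by bit, as vectors of length [n - k]. *)
apply: (@vec_inj (n - k)) => //; apply/ffunP => j; rewrite !ffunE.
rewrite -!divnMA -expnD.
have lt_kj : k + j < n by have := ltn_ord j; lia.
have := xy (Ordinal lt_kj); rewrite -{1}(bindexK x) -{1}(bindexK y) !ffunE.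
by apply; apply: leq_addr.
Qed.

Lemma sumn_take v m : sumn (take m v) = \sum_(0 <= l < m) nth 0 v l.
Proof.
elim: v m => [|a v IHv] m; first by rewrite big1 // => i _; rewrite nth_nil.
by case: m => [|m]; [rewrite big_geq | rewrite big_nat_recl //= IHv].
Qed.

Lemma leq_sumn_take v a b : a <= b -> sumn (take a v) <= sumn (take b v).
Proof.
by move=> le_ab; rewrite !sumn_take (@big_cat_nat _ _ _ a 0 b) //= leq_addr.
Qed.

(** Lay parts of lengths [v] end to end; [reshape_index v l] is the part containing position [l].
    Parts in different blocks of length [d] are separated by a partial sum that [d] divides, so
    their positions have different quotients by [d]. *)
Lemma reshape_index_divn v d l l' :
  0 < d -> (forall q, d %| sumn (take (q * d) v)) ->
  l < sumn v -> l' < sumn v ->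
  l %/ d = l' %/ d -> reshape_index v l %/ d = reshape_index v l' %/ d.
Proof.
move=> d0 dvd_v; wlog: l l' / reshape_index v l %/ d <= reshape_index v l' %/ d.
  move=> wl ltl ltl' e.
  by have [/wl|/ltnW/wl H] := leqP (reshape_index v l %/ d)
    (reshape_index v l' %/ d); [apply|apply/esym/H].
set r := reshape_index v l; set r' := reshape_index v l'.
rewrite leq_eqVlt => /orP[/eqP //|lt_r] ltl ltl' ell.
(* [m] is where the block of part [r] ends: [l] lies before it, [l'] does not. *)
have := dvd_v (r %/ d).+1; set m := sumn _ => dvd_m.
have lt_lm : l < m.
  apply: (@leq_trans (sumn (take r.+1 v))).
    rewrite -[l](reshape_indexK v) (take_nth 0) ?reshape_indexP // sumn_rcons.
    by rewrite ltn_add2l reshape_offsetP.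
  by apply: leq_sumn_take; rewrite ltn_ceil.
have le_ml' : m <= l'.
  apply: (@leq_trans (sumn (take r' v))).
    apply: leq_sumn_take; apply: leq_trans (leq_trunc_div r' d).
    by rewrite leq_mul2r lt_r orbT.
  by rewrite -[l'](reshape_indexK v) leq_addr.
move: lt_lm le_ml'; rewrite -(divnK dvd_m) -ltn_divLR // ell -leq_divRL //.
by lia.
Qed.

Lemma block_sequence_dvd n v k q :
  block_sequence n v -> k <= n -> 2 ^ k %| sumn (take (q * 2 ^ k) v).
Proof.
move=> [sz_v v_block] le_kn; elim: q => [|q IHq]; first by rewrite mul0n take0.
rewrite sumn_take (@big_cat_nat _ _ _ (q * 2 ^ k)) //=; last first.
  by rewrite leq_mul2r leqnSn orbT.
rewrite -sumn_take dvdn_addr //.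
have [lt_q|le_q] := ltnP q (2 ^ (n - k)).
  by apply/eqP; rewrite v_block // mod0n.
(* Beyond the end of [v] only the default 0 is summed. *)
rewrite big_nat big1 // => l /andP[le_l _]; rewrite nth_default // sz_v.
apply: leq_trans le_l; rewrite -(subnK le_kn) expnD leq_mul2r.
by rewrite le_q orbT.
Qed.

Lemma I_E {n} (P : seq {set bvec n}) (x : bvec n) :
  let v := [seq #|A : {set bvec n}| | A <- P] in
  bindex x < sumn v -> I_ P x = vec n (reshape_index v (bindex x)).
Proof.
move=> v lt_x; rewrite /I_ nth_flatten.
set ss := [seq nseq _ _ | i <- _].
have ss_shape : shape ss = v.
  rewrite /shape /ss -map_comp -[v](@mkseq_nth _ 0) /mkseq size_map.
  apply/eq_in_map => i; rewrite mem_iota /= add0n size_nseq => lt_i.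
  by rewrite (nth_map set0).
rewrite ss_shape; set r := reshape_index v _.
have lt_r : r < size P.
  by rewrite -(size_map (fun A : {set bvec n} => #|A|)) reshape_indexP.
rewrite (nth_map 0) ?size_iota // nth_iota // add0n nth_nseq.
by have := reshape_offsetP lt_x; rewrite (nth_map set0) // => ->.
Qed.

(** * Factorisation *)

Lemma card_bvec n : #|{: bvec n}| = 2 ^ n.
Proof. by rewrite card_ffun card_bool card_ord. Qed.

(** Meant for [a] selecting the non-empty members of [P], in which the empty set may recur. *)
Lemma uniq_filter_nth {T : eqType} (x0 : T) (a : pred T) (s : seq T) i j :
  uniq (filter a s) -> i < size s -> j < size s ->
  a (nth x0 s i) -> nth x0 s i = nth x0 s j -> i = j.
Proof.
elim: s i j => [|x s IHs] [|i] [|j] //= uniq_s lt_i lt_j a_i e.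
- by move: uniq_s; rewrite a_i /= mem_filter a_i e mem_nth.
- by move: uniq_s; rewrite -e a_i /= mem_filter a_i mem_nth.
congr _.+1; apply: IHs => //.
by move: uniq_s; case: (a x) => //= /andP[].
Qed.

(** The complements of [D] and of its image have the same size, so their enumerations can be
    matched. *)
Lemma injective_extension (T : finType) (D : {set T}) (f : T -> T) :
  {in D &, injective f} ->
  exists g : T -> T, injective g /\ {in D, g =1 f}.
Proof.
move=> f_inj; set s := enum (~: D); set s' := enum (~: (f @: D)).
have sz : size s = size s'.
  rewrite -!cardE; have := cardsC D; have := cardsC (f @: D).
  by rewrite card_in_imset //; lia.
pose g x := if x \in D then f x else nth x s' (index x s).
have lt_idx x : x \notin D -> index x s < size s'.
  by move=> xD; rewrite -sz index_mem mem_enum inE.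
have g_out x : x \notin D -> g x \notin f @: D.
  move=> xD; rewrite /g (negPf xD).
  by have := mem_nth x (lt_idx _ xD); rewrite mem_enum inE.
have g_in x : x \in D -> g x \in f @: D.
  by move=> xD; rewrite /g xD imset_f.
exists g; split=> [x y|x xD]; last by rewrite /g xD.
have [xD|xD] := boolP (x \in D); have [yD|yD] := boolP (y \in D) => e.
- by move: e; rewrite /g xD yD; apply: f_inj.
- by have := g_out _ yD; rewrite -e g_in.
- by have := g_out _ xD; rewrite e g_in.
move: e; rewrite /g (negPf xD) (negPf yD) (set_nth_default x y) ?lt_idx //.
move=> /eqP; rewrite nth_uniq ?enum_uniq ?lt_idx // => /eqP e.
by rewrite -[x](@nth_index _ x _ s) ?e ?nth_index // mem_enum inE.
Qed.

Lemma partition_sequence_card {n} {P : seq {set bvec n}} :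
  partition_sequence P -> sumn [seq #|A : {set bvec n}| | A <- P] = 2 ^ n.
Proof.
move=> [uniq_P /card_partition]; rewrite cardsT card_bvec => ->.
rewrite sumnE big_map (bigID (fun A : {set bvec n} => A != set0)) /=.
rewrite [X in _ + X]big1 ?addn0; last first.
  by move=> A; rewrite negbK => /eqP->; rewrite cards0.
by rewrite -big_filter big_uniq //; apply: eq_bigl => A; rewrite !inE.
Qed.

Lemma partition_sequence_cover {n} {P : seq {set bvec n}} (x : bvec n) :
  partition_sequence P -> exists2 A, A \in P & x \in A.
Proof.
move=> [_ /cover_partition/setP/(_ x)]; rewrite !inE => /bigcupP[A].
by rewrite inE mem_filter => /andP[_]; exists A.
Qed.

Lemma mem_nth_lt_size {n} (P : seq {set bvec n}) i x :
  x \in nth set0 P i -> i < size P.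
Proof. by case: ltnP => // le_i; rewrite nth_default // inE. Qed.

Lemma partition_sequence_nth_inj {n} {P : seq {set bvec n}} {i j} {x : bvec n} :
  partition_sequence P -> x \in nth set0 P i -> x \in nth set0 P j -> i = j.
Proof.
move=> [uniq_P /and3P[_ tI _]] xi xj.
have [lt_i lt_j] := (mem_nth_lt_size _ _ _ xi, mem_nth_lt_size _ _ _ xj).
have mem_P k : k < size P -> x \in nth set0 P k ->
    nth set0 P k \in [set A in nonempty_members P].
  move=> lt_k xk; rewrite inE mem_filter mem_nth // andbT.
  by apply/set0Pn; exists x.
have e : nth set0 P i = nth set0 P j.
  apply/eqP; apply: contraT => ne.
  have := trivIsetP tI _ _ (mem_P _ lt_i xi) (mem_P _ lt_j xj) ne.
  by move=> /disjointFr/(_ xi); rewrite xj.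
apply: (uniq_filter_nth _ _ _ _ _ uniq_P lt_i lt_j _ e).
by apply/set0Pn; exists x.
Qed.

(** With the empty fibres included, the list has length [2 ^ n] and its sizes sum to [2 ^ n], as
    [block_ordering] requires. *)
Lemma block_fibre_sequence_exists {n} (E : bvec n -> bvec n) :
  exists P, block_fibre_sequence E P.
Proof.
pose s := [seq fibre E y | y <- enum {: bvec n}].
have sz_s : size s = 2 ^ n by rewrite size_map -cardE card_bvec.
have fibreP x y : (x \in fibre E y) = (E x == y) by rewrite !inE.
have fibre_inj y z : fibre E y != set0 -> fibre E y = fibre E z -> y = z.
  case/set0Pn=> x xy e; move: (xy); rewrite {1}e !fibreP => /eqP <-.
  by move: xy; rewrite fibreP => /eqP.
have part_s : partition_sequence s.
  split.
    rewrite /nonempty_members filter_map map_inj_in_uniq.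
      by rewrite filter_uniq ?enum_uniq.
    by move=> y z; rewrite mem_filter => /andP[/= ne _] _; apply: fibre_inj.
  apply/and3P; split.
  - apply/eqP/setP => x; rewrite inE; apply/bigcupP.
    exists (fibre E (E x)); last by rewrite fibreP.
    rewrite inE mem_filter map_f ?mem_enum // andbT.
    by apply/set0Pn; exists x; rewrite fibreP.
  - apply/trivIsetP => A B; rewrite !inE !mem_filter.
    move=> /andP[_ /mapP[y _ ->]] /andP[_ /mapP[z _ ->]] ne.
    rewrite -setI_eq0; apply/set0Pn => -[x]; rewrite inE !fibreP.
    by case/andP=> /eqP ey /eqP ez; move: ne; rewrite -ey -ez eqxx.
  - by rewrite inE mem_filter eqxx.
have [||P [P_perm P_block]] :=
  block_ordering n _ (fun A : {set bvec n} => #|A|) s.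
- exact: sz_s.
- by rewrite -(big_map _ predT id) -sumnE partition_sequence_card.
have ne_perm : perm_eq (nonempty_members P) (nonempty_members s).
  exact: perm_filter.
exists P; split=> //; first by rewrite (perm_size P_perm).
  case: part_s => uniq_s part_s; split; first by rewrite (perm_uniq ne_perm).
  congr (partition _ _): part_s; apply/setP => A.
  by rewrite !inE (perm_mem ne_perm).
move=> A; rewrite (perm_mem ne_perm) mem_filter; split.
  by case/andP=> ne /mapP[y _ Ay]; split=> //; exists y.
by case=> -> [y ->]; rewrite map_f ?mem_enum.
Qed.

(* Partial sums over blocks of length 2 ^ k are multiples of 2 ^ k, so the
   preimage of an aligned block is a union of aligned blocks. *)
Lemma I_block {n} (P : seq {set bvec n}) k (x y : bvec n) :
  partition_sequence P -> block_sequence n [seq #|A : {set bvec n}| | A <- P] ->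
  k <= n -> (forall j : 'I_n, k <= j -> x j = y j) ->
  forall j : 'I_n, k <= j -> I_ P x j = I_ P y j.
Proof.
move=> part_P block_P le_kn xy j le_kj.
rewrite !I_E ?partition_sequence_card ?bindex_lt //.
apply: vec_divn le_kj; apply: reshape_index_divn.
- by rewrite expn_gt0.
- by move=> q; apply: block_sequence_dvd block_P le_kn.
- by rewrite partition_sequence_card ?bindex_lt.
- by rewrite partition_sequence_card ?bindex_lt.
exact: bindex_divn.
Qed.

(** [G] sends [x] to its position in [L], which lists the members of [P] one after another, as [I_]
    lays out its values. [F] extends the injection from [vec n i] to [y i] over the non-empty
    members. *)
Lemma P_factorisation_exists {n} (E : bvec n -> bvec n) P :
  block_fibre_sequence E P ->
  exists F I G : bvec n -> bvec n, P_factorisation P E F I G.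
Proof.
move=> [sz_P part_P fib_P _].
pose ss := [seq enum (A : {set bvec n}) | A <- P]; pose L := flatten ss.
have ss_shape : shape ss = [seq #|A : {set bvec n}| | A <- P].
  by rewrite /shape -map_comp; apply: eq_map => A /=; rewrite -cardE.
have sz_L : size L = 2 ^ n.
  by rewrite size_flatten ss_shape partition_sequence_card.
have mem_L x : x \in L.
  have [A AP xA] := partition_sequence_cover x part_P.
  by apply/flatten_mapP; exists A; rewrite ?mem_enum.
have lt_L x : index x L < 2 ^ n by rewrite -sz_L index_mem.
pose G x := vec n (index x L).
have G_inj : injective G.
  move=> x y /(vec_inj _ _ (lt_L x) (lt_L y)) e.
  by rewrite -(nth_index x (mem_L x)) e nth_index.
have IG x i : x \in nth set0 P i -> I_ P (G x) = vec n i.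
  rewrite I_E vecK ?partition_sequence_card ?lt_L // => xi; congr vec.
  apply: (partition_sequence_nth_inj part_P _ xi).
  have := nth_index x (mem_L x); rewrite nth_flatten ss_shape.
  set r := reshape_index _ _; set c := reshape_offset _ _ => rc.
  have lt_x : index x L < sumn [seq #|A : {set bvec n}| | A <- P].
    by rewrite partition_sequence_card.
  have lt_r : r < size P.
    by rewrite -(size_map (fun A : {set bvec n} => #|A|)) reshape_indexP.
  have := reshape_offsetP lt_x; rewrite -/r -/c (nth_map set0) // => lt_c.
  by rewrite -[x]rc (nth_map set0) // -mem_enum mem_nth // -cardE.
(* The value at an empty member is arbitrary, since [D] leaves it out. *)
pose y i := if [pick x in nth set0 P i] is Some x then E x else vec n 0.
have yP i : nth set0 P i != set0 -> nth set0 P i = fibre E (y i).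
  move=> ne; have lt_i : i < size P.
    by rewrite ltnNge; apply: contra ne => le_i; rewrite nth_default.
  have [|_ [z fz]] := (fib_P (nth set0 P i)).1.
    by rewrite mem_filter ne mem_nth.
  rewrite {1}fz /y; case: pickP => [x|no]; first by rewrite fz !inE => /eqP->.
  by case/set0Pn: ne => x; rewrite no.
pose D := [set x : bvec n | nth set0 P (bindex x) != set0].
have y_inj : {in D &, injective (fun x => y (bindex x))}.
  move=> a b; rewrite !inE => Da Db e; rewrite -(bindexK a) -(bindexK b).
  congr vec; case/set0Pn: (Da) => x xa.
  apply: (partition_sequence_nth_inj part_P xa).
  by rewrite yP // -e -yP.
have [F [F_inj FE]] := injective_extension _ _ _ y_inj.
exists F, (I_ P), G; split=> //.
- exact: injF_bij.
- move=> i lt_i; apply/setP => z; apply/imsetP/idP.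
    by case=> x xi ->; rewrite !inE (IG _ _ xi).
  rewrite !inE => /eqP Iz; have [H HK KH] := injF_bij G_inj.
  (* The [G]-preimage of [z] lies in some member [k]; comparing values of [I_ P] gives [k = i]. *)
  exists (H z); last by rewrite KH.
  have [A AP xA] := partition_sequence_cover (H z) part_P.
  have [k lt_k Ak] := nthP set0 AP; rewrite -Ak in xA.
  move: Iz; rewrite -[z]KH (IG _ _ xA) => /vec_inj <-; rewrite -?sz_P //.
  by rewrite KH.
- exact: injF_bij.
exists y => i lt_i ne; split; first exact: yP.
by rewrite FE ?inE vecK // -sz_P.
Qed.

Lemma P_factorisation_comp {n} {P} {E F I G : bvec n -> bvec n} x :
  partition_sequence P -> P_factorisation P E F I G -> F (I (G x)) = E x.
Proof.
move=> part_P [_ _ GP _ [y yP]].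
have [A AP xA] := partition_sequence_cover x part_P.
have [k lt_k Ak] := nthP set0 AP; rewrite -Ak in xA.
have ne : nth set0 P k != set0 by apply/set0Pn; exists x.
have [fk Fk] := yP k lt_k ne.
have : G x \in G @: nth set0 P k by apply: imset_f.
rewrite GP // !inE => /eqP->; rewrite Fk.
by move: xA; rewrite fk !inE => /eqP.
Qed.

(** * Recombination and networks *)

Lemma rev_iotaS m : rev (iota 1 m.+1) = m.+1 :: rev (iota 1 m).
Proof. by rewrite -[m.+1 in LHS]addn1 iotaD rev_cat. Qed.

Lemma last_up m : last 1 (iota 2 m) = m.+1.
Proof.
by case: m => // m; rewrite -(addn1 m) iotaD last_cat /=; lia.
Qed.

Lemma last_down m : last m.+1 (rev (iota 1 m)) = 1.
Proof. by case: m => // m; rewrite rev_cons last_rcons. Qed.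

(** The only equal neighbours are the two letters 1 where [sig_updown n] meets [sig_up n]; the rest
    runs strictly up and down. *)
Lemma compress_signature_main n : 0 < n ->
  compress (sig_updown n ++ sig_up n ++ sig_down n) = sig_main n.
Proof.
case: n => // m _.
have [s sE] : exists s, sig_updown m.+1 = rcons s 1.
  exists (belast 1 (iota 2 m ++ rev (iota 1 m))).
  have := lastI 1 (iota 2 m ++ rev (iota 1 m)).
  by rewrite last_cat last_up last_down.
rewrite sE [sig_up m.+1]/= compress_cat -sE /sig_updown -catA.
rewrite -/(sig_main m.+1); apply: compress_id.
have up : path (fun a b => a != b) 1 (iota 2 m).
  rewrite -[path _ _ _]/(sorted _ (iota 1 m.+1)).
  by apply: (sub_sorted _ (iota_ltn_sorted 1 m.+1)) => a b; lia.
have down : path (fun a b => a != b) m.+1 (rev (iota 1 m)).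
  rewrite -[path _ _ _]/(sorted _ (m.+1 :: rev (iota 1 m))).
  rewrite -rev_iotaS rev_sorted.
  by apply: (sub_sorted _ (iota_ltn_sorted 1 m.+1)) => a b; lia.
rewrite /sig_main /sig_up /sig_down /= !cat_path.
by rewrite !(last_up, last_down) up down.
Qed.

Lemma size_sig_main n : 0 < n -> size (sig_main n) = 4 * n - 3.
Proof. by move=> n0; rewrite !size_cat !size_rev !size_iota; lia. Qed.

Section Recombination.

Context {n : nat} {E F I G : bvec n -> bvec n} {P : seq {set bvec n}}.
Hypotheses (n_gt0 : 0 < n) (EP : block_fibre_sequence E P).
Hypothesis (fact : P_factorisation P E F I G).

Lemma P_factorisation_programs :
  (exists pG : program n,
     in_situ_program pG G /\ signature pG = sig_updown n) /\
  (exists pF : program n,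
     in_situ_program pF F /\ signature pF = sig_updown n).
Proof.
case: fact => _ /bij_inj G_inj _ /bij_inj F_inj _.
by split; apply: bijection_program.
Qed.

Context {pG pF : program n}.
Hypotheses (pGE : in_situ_program pG G) (pG_sig : signature pG = sig_updown n).
Hypotheses (pFE : in_situ_program pF F) (pF_sig : signature pF = sig_updown n).

Lemma signature_take_updown : signature (take n pF) = sig_up n.
Proof. by rewrite signature_take pF_sig take_size_cat ?size_iota. Qed.

Lemma signature_drop_updown : signature (drop n pF) = sig_down n.
Proof. by rewrite signature_drop pF_sig drop_size_cat ?size_iota. Qed.

(* Points that B o I could confuse lie in a common aligned block, which I sends
   into one aligned block, and on such a block every prefix of B is injective. *)
Lemma program_BI : exists pBI : program n,
  in_situ_program pBI (run (take n pF) \o I) /\ signature pBI = sig_up n.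
Proof.
case: EP => [_ part_P _ block_P]; case: fact => IE _ _ F_bij _.
apply: up_program => k x y le_kn Bxy xy /=; congr run.
(* The remaining assignments of [pF] complete this prefix to the injective [F]. *)
have run_k_inj : injective (run (take k (take n pF))).
  apply: (@inj_compr _ _ _ (run (drop k (take n pF) ++ drop n pF))).
  apply: eq_inj (bij_inj F_bij) _ => z /=.
  by rewrite -run_cat catA !cat_take_drop pFE.
apply: run_k_inj; apply/ffunP => j.
(* Components below [k] agree by [Bxy]; the others are still those of [I x] and [I y], which agree
   by [I_block]. *)
rewrite !(run_take_up _ k _ _ signature_take_updown).
case: ltnP => [|le_kj]; first exact: Bxy.
by rewrite !IE (I_block _ k x y).
Qed.

Context {pBI : program n}.
Hypotheses (pBIE : in_situ_program pBI (run (take n pF) \o I))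
           (pBI_sig : signature pBI = sig_up n).

Lemma run_factorisation : in_situ_program (pG ++ pBI ++ drop n pF) E.
Proof.
case: EP => [_ part_P _ _] x.
rewrite !run_cat pGE pBIE /= -run_cat cat_take_drop.
by rewrite pFE (P_factorisation_comp _ part_P fact).
Qed.

Lemma merged_program :
  let p := merge_program (pG ++ pBI ++ drop n pF) in
  [/\ in_situ_program p E, size p = 4 * n - 3 & signature p = sig_main n].
Proof.
move=> p; have p_sig : signature p = sig_main n.
  rewrite signature_merge !signature_cat pG_sig pBI_sig signature_drop_updown.
  exact: compress_signature_main.
split=> //; last by rewrite -size_signature p_sig size_sig_main.
by move=> x; rewrite run_merge run_factorisation.
Qed.

End Recombination.

(** * Networks of programs *)

Definition program_network {n} (p : program n) : MIN n :=
  flatten [seq A_ a.2 | a <- p].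

Lemma program_networkE {n} (p : program n) :
  program_network p =
  [seq (fun x y => [exists e : bool, y == update x a.2 e]) | a <- p].
Proof. by elim: p => //= a p <-. Qed.

Definition step {n} (p : program n) (k : nat) : bvec n -> bvec n :=
  nth id [seq (fun x => assign x a) | a <- p] k.

Lemma run_take_step {n} (p : program n) k x : k < size p ->
  run (take k.+1 p) x = step p k (run (take k p) x).
Proof.
by elim: p k x => //= a p IHp [|k] x lt_k; [rewrite take0 | apply: IHp].
Qed.

Lemma program_network_edge {n} (p : program n) k x : k < size p ->
  nth (@no_edge n) (program_network p) k x (step p k x).
Proof.
rewrite program_networkE; elim: p k => //= a p IHp [|k] lt_k; last exact: IHp.
by apply/existsP; exists (a.1 x).
Qed.

Lemma size_program_network {n} (p : program n) :
  size (program_network p) = size p.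
Proof. by rewrite program_networkE size_map. Qed.

Lemma program_routing {n} (p : program n) :
  exists C, routing_performs (program_network p) C (run p).
Proof.
exists (fun k x y => y == step p k x).
split; first split; rewrite ?size_program_network.
- move=> k x y; rewrite size_program_network => lt_k /eqP->.
  exact: program_network_edge.
- move=> k x _; rewrite -(cards1 (step p k x)); apply: eq_card => y.
  by rewrite !inE.
move=> x; exists (fun k => run (take k p) x).
rewrite size_program_network take0 take_size; split=> // k lt_k.
by rewrite run_take_step.
Qed.

(** Hence reversing a program amounts to turning round the edges of its network. *)
Lemma edge_sym {n} (i : 'I_n) (x y : bvec n) :
  [exists e : bool, y == update x i e] -> [exists e : bool, x == update y i e].
Proof.
case/existsP=> e /eqP->; apply/existsP; exists (x i).
by rewrite update_update update_id.
Qed.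

(** Read backwards, the run of [p] from [z] is the only chosen path ending at [z], and it starts at
    [run p z]. *)
Lemma program_multicast {n} (p : program n) :
  exists C,
    multicast_routing_performs_inverse (program_network (rev p)) C (run p).
Proof.
have sz : size (program_network (rev p)) = size p.
  by rewrite size_program_network size_rev.
(* Edges leaving stage [k] belong to assignment [size p - k.+1] of [p], counted from 0. *)
exists (fun k x y => x == step p (size p - k.+1) y); split.
- move=> k x y; rewrite sz => lt_k /eqP->.
  have lt_k' : size p - k.+1 < size p by lia.
  have := program_network_edge p _ y lt_k'; move: lt_k lt_k'.
  case: p {sz} => // a p lt_k lt_k'; rewrite !program_networkE map_rev.
  by rewrite nth_rev ?size_map // !(nth_map a) //; apply: edge_sym.
- move=> k y _; rewrite -(cards1 (step p (size p - k.+1) y)).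
  by apply: eq_card => x; rewrite !inE.
move=> y z; rewrite !inE; split.
  case=> w []; rewrite sz => w0 wz wC; apply/eqP.
  have run_w k : k <= size p -> run (take k p) z = w (size p - k).
    elim: k => [|k IHk] le_k; first by rewrite take0 subn0 wz.
    rewrite run_take_step // (IHk (ltnW le_k)).
    have lt : size p - k.+1 < size p by lia.
    have /eqP -> := wC _ lt; congr (step p _ (w _)); lia.
  by rewrite -[p in run p]take_size run_w // subnn.
move=> /eqP <-; exists (fun k => run (take (size p - k) p) z).
rewrite sz subn0 subnn take0 take_size; split=> // k lt_k.
by rewrite -run_take_step; [rewrite subnSK | lia].
Qed.

(* A no-op on component n doubles the middle of 1, ..., n, ..., 1. *)
Lemma pad_program {n} (p : program n) : 0 < n -> signature p = sig_updown n ->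
  exists q : program n,
    run q =1 run p /\ map snd q = enum 'I_n ++ rev (enum 'I_n).
Proof.
case: n p => // m p _ p_sig.
pose noop : assignment m.+1 := (fun x : bvec m.+1 => x ord_max, ord_max).
exists (take m.+1 p ++ noop :: drop m.+1 p); split.
  move=> x; rewrite -[p in RHS](cat_take_drop m.+1 p) !run_cat /=.
  exact: (congr1 (run _) (update_id _ _)).
have ord_inj : injective (fun i : 'I_m.+1 => i.+1) by move=> i j [/val_inj].
have enumE : [seq i.+1 | i : 'I_m.+1 <- enum 'I_m.+1] = iota 1 m.+1.
  by rewrite (map_comp S val) val_enum_ord -(iotaDl 1).
apply: (inj_map ord_inj); rewrite [RHS]map_cat map_rev enumE -map_comp.
rewrite -[LHS]/(signature _) -cat1s !signature_cat.
rewrite signature_take signature_drop p_sig /sig_updown.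
rewrite take_size_cat ?drop_size_cat ?size_iota //.
by rewrite rev_iotaS.
Qed.

(** Without merging, [pG] and [pBI ++ drop n pF] each have signature 1, ..., n, ..., 1, and each is
    padded on its own. *)
Lemma butterfly_program {n} (E : bvec n -> bvec n) : 0 < n ->
  exists q : program n, run q =1 E /\
    map snd q = (enum 'I_n ++ rev (enum 'I_n)) ++ enum 'I_n ++ rev (enum 'I_n).
Proof.
move=> n_gt0.
have [P EP] := block_fibre_sequence_exists E.
have [F [I [G fact]]] := P_factorisation_exists E P EP.
have [[pG [pGE pG_sig]] [pF [pFE pF_sig]]] :=
  P_factorisation_programs n_gt0 fact.
have [pBI [pBIE pBI_sig]] := program_BI EP fact pFE pF_sig.
have [qG [qGE qG_sig]] := pad_program pG n_gt0 pG_sig.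
have [|qF [qFE qF_sig]] := pad_program (pBI ++ drop n pF) n_gt0.
  by rewrite signature_cat pBI_sig (signature_drop_updown pF_sig).
exists (qG ++ qF); split; last by rewrite map_cat qG_sig qF_sig.
move=> x; rewrite run_cat qGE qFE -run_cat.
exact: (run_factorisation EP fact).
Qed.

(* For E conjugated by the reversal of the components, this turns a program
   with signature 1, ..., n, n, ..., 1, ... into one for E with signature
   n, ..., 1, 1, ..., n, .... *)
Definition reverse_vec {n} (x : bvec n) : bvec n := [ffun i => x (rev_ord i)].

Lemma reverse_vecK {n} : involutive (@reverse_vec n).
Proof. by move=> x; apply/ffunP => i; rewrite !ffunE rev_ordK. Qed.

Definition reverse_program {n} (p : program n) : program n :=
  [seq (fun x => a.1 (reverse_vec x), rev_ord a.2) | a <- p].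

Lemma run_reverse_program {n} (p : program n) x :
  run (reverse_program p) x = reverse_vec (run p (reverse_vec x)).
Proof.
elim: p x => [|a p IHp] x /=; first by rewrite reverse_vecK.
rewrite IHp; congr (reverse_vec (run p _)); apply/ffunP => i.
by rewrite !ffunE /= (inj_eq rev_ord_inj).
Qed.

Lemma map_rev_ord_enum n : map (@rev_ord n) (enum 'I_n) = rev (enum 'I_n).
Proof.
case: n => [|m]; first by rewrite [enum _]size0nil // size_enum_ord.
apply: (@eq_from_nth _ ord0); first by rewrite size_map size_rev.
move=> i; rewrite size_map size_enum_ord => lt_i.
rewrite (nth_map ord0) ?size_enum_ord // nth_rev ?size_enum_ord //.
by apply: val_inj; rewrite /= !nth_enum_ord //; lia.
Qed.

Theorem theorem25 (n : nat) (hn : 1 <= n) (E : bvec n -> bvec n) :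
  (exists p : program n,
     [/\ in_situ_program p E, size p = 4 * n - 3 & signature p = sig_main n])
  /\ (exists P : seq {set bvec n}, block_fibre_sequence E P)
  /\ (forall P : seq {set bvec n}, block_fibre_sequence E P ->
        (exists F I G : bvec n -> bvec n, P_factorisation P E F I G) /\
        forall F I G : bvec n -> bvec n, P_factorisation P E F I G ->
          (exists pG : program n,
             in_situ_program pG G /\ signature pG = sig_updown n) /\
          (exists pF : program n,
             in_situ_program pF F /\ signature pF = sig_updown n) /\
          forall pG pF : program n,
            in_situ_program pG G -> signature pG = sig_updown n ->
            in_situ_program pF F -> signature pF = sig_updown n ->
            let B := run (take n pF) in
            (exists pBI : program n,
               in_situ_program pBI (B \o I) /\ signature pBI = sig_up n) /\
            forall pBI : program n,
              in_situ_program pBI (B \o I) -> signature pBI = sig_up n ->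
              let p := merge_program (pG ++ pBI ++ drop n pF) in
              [/\ in_situ_program p E,
                  size p = 4 * n - 3
                & signature p = sig_main n])
  /\ (exists C : nat -> rel (bvec n),
        routing_performs
          (inv_butterfly n ++ butterfly n ++ inv_butterfly n ++ butterfly n)
          C E)
  /\ (exists C : nat -> rel (bvec n),
        multicast_routing_performs_inverse
          (butterfly n ++ inv_butterfly n ++ butterfly n ++ inv_butterfly n)
          C E).
Proof.
have [P EP] := block_fibre_sequence_exists E.
have [F [I [G fact]]] := P_factorisation_exists E P EP.
have [[pG [pGE pG_sig]] [pF [pFE pF_sig]]] := P_factorisation_programs hn fact.
have [pBI [pBIE pBI_sig]] := program_BI EP fact pFE pF_sig.
split.
  exists (merge_program (pG ++ pBI ++ drop n pF)).
  exact: (merged_program hn EP fact).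
split; first by exists P.
split.
  move=> P' EP'; split; first exact: P_factorisation_exists.
  move=> F' I' G' fact'; have [hG hF] := P_factorisation_programs hn fact'.
  split=> //; split=> // pG' pF' pG'E pG'_sig pF'E pF'_sig; split.
    exact: (program_BI EP' fact').
  by move=> pBI' pBI'E pBI'_sig; apply: (merged_program hn EP' fact').
have netE (q : program n) :
    program_network q = flatten [seq A_ i | i <- map snd q].
  by rewrite -map_comp.
split.
  have [q [qE q_sig]] := butterfly_program E hn.
  have [C [rC pC]] := program_routing q; exists C.
  move: rC pC; rewrite netE q_sig !map_cat !flatten_cat.
  by rewrite -!catA => rC pC; split=> // x; rewrite -qE.
have [q [qE q_sig]] :=
  butterfly_program (fun x => reverse_vec (E (reverse_vec x))) hn.
have [C [eC uC pC]] := program_multicast (reverse_program q); exists C.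
have rq_sig : map snd (reverse_program q) =
    (rev (enum 'I_n) ++ enum 'I_n) ++ rev (enum 'I_n) ++ enum 'I_n.
  transitivity (map (@rev_ord n) (map snd q)); first by rewrite -!map_comp.
  by rewrite q_sig !map_cat !map_rev map_rev_ord_enum !revK.
(* The word in [rq_sig] equals its own reversal, so the reversed program still has the required
   network. *)
move: eC uC pC; rewrite netE map_rev rq_sig !rev_cat !revK.
rewrite !map_cat !flatten_cat -!catA => eC uC pC; split=> // y z.
by rewrite pC !inE run_reverse_program qE !reverse_vecK.
Qed.
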